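(* Let $\mathbf{x}=(\mathrm{x}_i)_{1\le i\le m}\in\{-1,+1\}^m$ be such that $S_j(\mathbf{x})>0$ for every $j\in\{1,\dots,m-1\}$. Suppose there exists $k\in\{1,\dots,m-1\}$ such that $\mathrm{x}_1=\mathrm{x}_2=\cdots=\mathrm{x}_k=+1$ and $\mathrm{x}_{k+1}=-1$. Let $\hat{\mathbf{x}}=(\mathrm{x}_1,\dots,\mathrm{x}_{k-1},\mathrm{x}_{k+2},\dots,\mathrm{x}_m)$ be the sequence obtained from $\mathbf{x}$ by removing $\mathrm{x}_k$ and $\mathrm{x}_{k+1}$. Then $$\mathsf{H}(\mathcal{T}(\hat{\mathbf{x}}))\preceq_{\mathrm{st}}\mathsf{H}(\mathcal{T}(\mathbf{x})).$$
   Context: Uniform attachment with freezing. For a choice sequence $\mathbf{x}=(\mathrm{x}_i)_{1\le i\le m}\in\{-1,+1\}^m$ let $S_0(\mathbf{x})=1$ and $S_j(\mathbf{x})=1+\sum_{i=1}^j \mathrm{x}_i$ for $1\le j\le m$. Assume $S_j(\mathbf{x})>0$ for every $1\le j\le m-1$. Random rooted trees $\mathcal{T}_0(\mathbf{x}),\dots,\mathcal{T}_m(\mathbf{x})$, whose vertices are each labelled either active or frozen, are built recursively: $\mathcal{T}_0(\mathbf{x})$ is a single active root vertex; for $1\le j\le m$, let $V_j$ be a uniformly random active vertex of $\mathcal{T}_{j-1}(\mathbf{x})$, chosen independently of all previous choices; if $\mathrm{x}_j=-1$ (freezing step), $\mathcal{T}_j(\mathbf{x})$ is obtained from $\mathcal{T}_{j-1}(\mathbf{x})$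 by changing the label of $V_j$ from active to frozen; if $\mathrm{x}_j=+1$ (attachment step), $\mathcal{T}_j(\mathbf{x})$ is obtained from $\mathcal{T}_{j-1}(\mathbf{x})$ by adding a new active vertex joined by an edge to $V_j$. Thus $S_j(\mathbf{x})$ is the number of active vertices of $\mathcal{T}_j(\mathbf{x})$. Set $\mathcal{T}(\mathbf{x})=\mathcal{T}_m(\mathbf{x})$ (for the empty sequence, $m=0$, this is the single root vertex). The height $\mathsf{H}(T)$ of a rooted tree $T$ is the maximal graph distance of a vertex of $T$ to the root. For real random variables $X,Y$, $X\preceq_{\mathrm{st}}Y$ means that $Y$ stochastically dominates $X$: $\mathbb{P}(X\ge t)\le\mathbb{P}(Y\ge t)$ for every $t\in\mathbb{R}$. *)

(* Defs.v *)
From HB Require Import structures.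
From mathcomp Require Import all_boot all_order all_algebra.
From mathcomp Require Import all_classical all_reals all_analysis.

Set Implicit Arguments.
Unset Strict Implicit.
Unset Printing Implicit Defensive.

Import Order.TTheory GRing.Theory Num.Theory.
Local Open Scope classical_set_scope.
Local Open Scope ring_scope.

(* The vertices are 0, ..., size labels - 1 in order of appearance and 0 is   *)
(* the root; [nth false labels v] is true iff v is active.                    *)
Record tree := Tree { labels : seq bool; edges : seq (nat * nat) }.

Definition vertices (T : tree) : seq nat := iota 0 (size (labels T)).

Definition active_vertices (T : tree) : seq nat :=
  [seq v <- vertices T | nth false (labels T) v].

Definition root_tree : tree := Tree [:: true] [::].

Definition freeze (T : tree) (v : nat) : tree :=
  Tree (set_nth false (labels T) v false) (edges T).

Definition attach (T : tree) (v : nat) : tree :=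
  Tree (rcons (labels T) true) ((v, size (labels T)) :: edges T).

Definition adjacent (T : tree) (u v : nat) : bool :=
  ((u, v) \in edges T) || ((v, u) \in edges T).

Fixpoint has_walk (T : tree) (n : nat) (u v : nat) : bool :=
  if n is n'.+1 then
    has (fun w => adjacent T u w && has_walk T n' w v) (vertices T)
  else u == v.

(* Least length of a walk from u to v. A shortest walk visits each vertex at  *)
(* most once, so the lengths below the number of vertices suffice.            *)
Definition distance (T : tree) (u v : nat) : nat :=
  find (fun n => has_walk T n u v) (iota 0 (size (labels T))).

Definition height (T : tree) : nat :=
  (\max_(v <- vertices T) distance T 0 v)%N.

Definition partial_sum (x : seq int) (j : nat) : int := 1 + \sum_(0 <= i < j) x`_i.

Definition step (T : tree) (xj : int) (v : nat) : tree :=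
  if xj == 1 then attach T v else freeze T v.

(* The tree obtained after the steps of x when the successively chosen        *)
(* vertices are the entries of v.                                             *)
Definition build (x : seq int) (v : seq nat) : tree :=
  foldl (fun T s => step T s.1 s.2) root_tree (zip x v).

Section random_trees.
Context d (Omega : measurableType d) (R : realType) (P : probability Omega R).

(* Indices are shifted by one: V j is the vertex chosen at step j + 1.        *)
Definition choices (V : nat -> {RV P >-> nat}) (j : nat) (w : Omega) :
  seq nat := mkseq (fun i => V i w) j.

Definition uniform_on (s : seq nat) (u : nat) : R :=
  if u \in s then (size s)%:R^-1 else 0.

(* Given any past v of j choices, V j is uniform on the active vertices of    *)
(* the tree built from v.                                                     *)
Definition uniform_attachment_freezing (x : seq int)
    (V : nat -> {RV P >-> nat}) : Prop :=
  forall (j : nat) (v : seq nat) (u : nat),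
    (j < size x)%N -> size v = j ->
    (P [set w | choices V j w = v /\ V j w = u] =
     P [set w | choices V j w = v] *
       (uniform_on (active_vertices (build (take j x) v)) u)%:E)%E.

Definition random_tree (x : seq int) (V : nat -> {RV P >-> nat})
    (w : Omega) : tree := build x (choices V (size x) w).

Definition random_height (x : seq int) (V : nat -> {RV P >-> nat})
    (w : Omega) : R := (height (random_tree x V w))%:R.

Lemma measurable_choices (V : nat -> {RV P >-> nat}) (j : nat)
    (A : set (seq nat)) : measurable [set w | A (choices V j w)].
Proof.
elim: j A => [|j IHj] A.
  have [A0|A0] := pselect (A [::]).
    rewrite (_ : [set _ | _] = setT); first exact: measurableT.
    by apply/seteqP; split.
  by rewrite (_ : [set _ | _] = set0) //; apply/seteqP; split.
rewrite (_ : [set _ | _] = \bigcup_n (V j @^-1` [set n] `&`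
    [set w | [set s | A (rcons s n)] (choices V j w)])).
  apply: bigcup_measurable => n _; apply: measurableI; last exact: IHj.
  by rewrite -[X in measurable X]setTI; exact: measurable_funP.
apply/seteqP; split => [w /=|w [n _ /= [<-]]]; rewrite /choices mkseqS //.
by move=> Aw; exists (V j w).
Qed.

Lemma measurable_random_height (x : seq int) (V : nat -> {RV P >-> nat}) :
  measurable_fun setT (random_height x V).
Proof.
move=> _ B _; rewrite setTI.
exact: (measurable_choices V (size x) [set s | B (height (build x s))%:R]).
Qed.

HB.instance Definition _ (x : seq int) (V : nat -> {RV P >-> nat}) :=
  isMeasurableFun.Build _ _ _ _ (random_height x V)
    (measurable_random_height x V).

Definition height_rv (x : seq int) (V : nat -> {RV P >-> nat}) : {RV P >-> R} :=
  random_height x V.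

End random_trees.

Definition stochastically_dominated (R : realType)
    (d1 : measure_display) (Omega1 : measurableType d1)
    (P1 : probability Omega1 R) (X : {RV P1 >-> R})
    (d2 : measure_display) (Omega2 : measurableType d2)
    (P2 : probability Omega2 R) (Y : {RV P2 >-> R}) : Prop :=
  forall t : R, (P1 [set w | (t <= X w)%R] <= P2 [set w | (t <= Y w)%R])%E.

(* Removes the k-th and (k+1)-st entries, counted from 1.                     *)
Definition remove_pair (x : seq int) (k : nat) : seq int :=
  take k.-1 x ++ drop k.+1 x.

(* Main.v *)
Require Import Defs.
From mathcomp Require Import all_boot all_order all_algebra.
From mathcomp Require Import all_classical all_reals all_analysis.
From mathcomp Require Import zify ring lra.

Set Implicit Arguments.
Unset Strict Implicit.
Unset Printing Implicit Defensive.

Import Order.TTheory GRing.Theory Num.Theory.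
Local Open Scope ring_scope.

(** The height only depends on the evolution of the profile of the tree: the
multiset of depths of the active vertices, together with the height. In terms
of profiles, an attachment picks a uniform depth d of the multiset and adds
d + 1 to it, and a freezing removes a uniform depth. Let A and F be the
operators sending a function f of profiles to its expectation after one
attachment and after one freezing. Both preserve functions that increase when
the depths and the height increase, because two profiles whose depths are
matched in pairs d <= e can choose matched depths ([increasing_step]).

If x starts with k attachments and a freezing and g is the expectation, after
the remaining steps, of the indicator that the height is at least t, then the
two probabilities to compare are A^(k-1) g and A^k (F g), evaluated at the
profile of the single root; so everything reduces to
  A^(k-1) g <= A^k (F g)  for increasing g  ([expect_attach_freeze_root]).

The heart of the proof is an inequality at a profile with n active vertices
([expect_attach_freeze_ge]):
  (n + 1) A (F g) >= 2 g + (n - 1) F (A g).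
Attach a vertex to v, then freeze u. If u is the new vertex (probability
1/(n+1)), the active depths are unchanged and the height did not decrease. If
u = v (probability 1/(n+1)), one active depth was replaced by its successor.
Otherwise (probability (n-1)/(n+1)), the pair (v, u) is uniform among the
ordered pairs of distinct active vertices, and the outcome is that of first
freezing u and then attaching to the uniform remaining vertex v. At n = k + 1,
applying A^k at the root and the induction hypothesis to the increasing
function A g yields (k + 2) A^(k+1) (F g) >= 2 A^k g + k A^k g.

It remains to see that the profile of a tree does evolve as claimed, that is,
that the graph distances to the root behave like depths ([profile_attach],
[profile_freeze]), and that the law of the height is given by the iterated
operators ([prob_height]). *)

(** * Expectations along the evolution of a profile *)

Section profiles.
Variable R : realType.
Implicit Types (f : seq nat * nat -> R) (p q : seq nat * nat).

Definition mean (s : seq nat) (g : nat -> R) : R :=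
  (size s)%:R^-1 * \sum_(d <- s) g d.

(** A profile p lists the depths of the active vertices in p.1, in an arbitrary
order, and has the height of the tree as p.2. *)
Definition expect_step (xj : int) f p : R :=
  if xj == 1 then mean p.1 (fun d => f (d.+1 :: p.1, maxn p.2 d.+1))
  else mean p.1 (fun d => f (rem d p.1, p.2)).

Definition expect_steps (x : seq int) f : seq nat * nat -> R := foldr expect_step f x.

(** The list z of matched pairs, rather than an entrywise comparison, makes the
relation insensitive to permutations and can be used as a coupling of uniform
choices in s and in t. *)
Definition dominated (s t : seq nat) : Prop :=
  exists2 z : seq (nat * nat), all (fun c => c.1 <= c.2)%N z &
    perm_eq (unzip1 z) s /\ perm_eq (unzip2 z) t.

Definition increasing f : Prop := forall s t h h',
  dominated s t -> (h <= h')%N -> f (s, h) <= f (t, h').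

Lemma perm_dominated s t : perm_eq s t -> dominated s t.
Proof.
move=> st; exists [seq (d, d) | d <- s]; first by rewrite all_map; apply/allP=> d _ /=.
by rewrite /unzip1 /unzip2 -!map_comp !map_id.
Qed.

Lemma dominated_cons d e s t : (d <= e)%N -> dominated s t ->
  dominated (d :: s) (e :: t).
Proof.
move=> de [z zle [z1 z2]]; exists ((d, e) :: z); first by rewrite /= de.
by rewrite /= !perm_cons.
Qed.

Lemma increasing_perm f s t h : increasing f -> perm_eq s t ->
  f (s, h) = f (t, h).
Proof.
move=> fI st; apply/le_anti/andP; split; apply: fI => //; apply: perm_dominated => //.
by rewrite perm_sym.
Qed.

(** Both processes choose matched depths c.1 <= c.2; attaching to these or
removing these preserves the matching. *)
Lemma increasing_step xj f : increasing f -> increasing (expect_step xj f).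
Proof.
move=> fI s t h h' [z zle [z1 z2]] hh'.
have szst : size s = size t.
  by rewrite -(perm_size z1) -(perm_size z2) !size_map.
have le_mean g1 g2 : {in z, forall c, g1 c.1 <= g2 c.2} -> mean s g1 <= mean t g2.
  move=> g12; rewrite /mean szst ler_wpM2l ?invr_ge0 ?ler0n //.
  rewrite -(perm_big _ z1) -(perm_big _ z2) !big_map /= big_seq [leRHS]big_seq.
  by apply: ler_sum => c /g12.
rewrite /expect_step /=; case: ifP => _; apply: le_mean => c cz.
  have cle : (c.1 <= c.2)%N by apply: (allP zle).
  apply: fI; last by lia.
  by apply: dominated_cons; [lia | exists z].
apply: fI => //; exists (rem c z).
  by apply/allP => e /mem_rem /(allP zle).
have zc := perm_to_rem cz.
split.
  have sc : c.1 \in s by rewrite -(perm_mem z1); apply: map_f.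
  rewrite -(perm_cons c.1) -(permPr (perm_to_rem sc)) -(permPr z1).
  by rewrite perm_sym; have := perm_map fst zc.
have tc : c.2 \in t by rewrite -(perm_mem z2); apply: map_f.
rewrite -(perm_cons c.2) -(permPr (perm_to_rem tc)) -(permPr z2).
by rewrite perm_sym; have := perm_map snd zc.
Qed.

Lemma increasing_steps x f : increasing f -> increasing (expect_steps x f).
Proof. by move=> fI; elim: x => //= xj x IH; apply: increasing_step. Qed.

(** The comparison of f and g is only needed at the possible numbers of active
vertices after the step; this is how [expect_attach_freeze_ge], whose
coefficients depend on that number, is used after several attachments. *)
Lemma le_expect_step xj f g p :
  (forall q, size q.1 = (if xj == 1 then (size p.1).+1 else (size p.1).-1) ->
     f q <= g q) ->
  expect_step xj f p <= expect_step xj g p.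
Proof.
move=> fg; rewrite /expect_step; case: ifP fg => _ fg;
  rewrite /mean ler_wpM2l ?invr_ge0 ?ler0n // big_seq [leRHS]big_seq;
  apply: ler_sum => d dp; apply: fg => //=.
by rewrite size_rem.
Qed.

Lemma le_expect_attachments n f g p :
  (forall q, size q.1 = (size p.1 + n)%N -> f q <= g q) ->
  expect_steps (nseq n 1) f p <= expect_steps (nseq n 1) g p.
Proof.
elim: n p => [|n IHn] p fg; first by apply: fg; rewrite addn0.
by apply: le_expect_step => q /= qp; apply: IHn => r rq; apply: fg; rewrite rq qp addSnnS.
Qed.

(** After an attachment to d, the entry e to be frozen is either the new vertex,
or one of the n previous ones. In the second case, exchanging the two sums
makes e the first choice: the term d = e dominates f p, and the others form
the expectation of freezing e first and then attaching to d. *)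
Lemma expect_attach_freeze_ge f p : increasing f -> (0 < size p.1)%N ->
  2 * f p + (size p.1).-1%:R * expect_step (-1) (expect_step 1 f) p <=
  (size p.1).+1%:R * expect_step 1 (expect_step (-1) f) p.
Proof.
case: p => s h fI /= s0; rewrite /expect_step /= /mean.
have kE : (size s)%:R != 0 :> R by rewrite pnatr_eq0; lia.
have k0 : 0 < (size s)%:R :> R by rewrite ltr0n.
rewrite -(ler_pM2l k0).
set F := fun d e : nat => f (d.+1 :: rem e s, maxn h d.+1).
have -> : (size s)%:R * ((size s).+1%:R * ((size s)%:R^-1 *
      \sum_(d <- s) ((size s).+1%:R^-1 *
        \sum_(e <- d.+1 :: s) f (rem e (d.+1 :: s), maxn h d.+1))))
   = \sum_(d <- s) f (s, maxn h d.+1) + \sum_(e <- s) \sum_(d <- s) F d e.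
  rewrite -mulr_sumr exchange_big /= -big_split /=.
  have -> (a b c : R) : a * (b * (a^-1 * (b^-1 * c))) = (a / a) * (b / b) * c by ring.
  rewrite !divff ?mul1r ?pnatr_eq0 -?lt0n //.
  apply: eq_bigr => d _; rewrite big_cons /= eqxx; congr (_ + _).
  apply: eq_big_seq => e es; apply: increasing_perm => //.
  by case: eqP => [->|_] //; exact: perm_to_rem.
have -> : (size s)%:R * (2 * f (s, h) + (size s).-1%:R * ((size s)%:R^-1 *
      \sum_(e <- s) ((size (rem e s))%:R^-1 * \sum_(d <- rem e s) F d e)))
   = \sum_(d <- s) f (s, h) + \sum_(e <- s) (f (s, h) + \sum_(d <- rem e s) F d e).
  rewrite big_split /= !big_const_seq !count_predT !iter_addr_0.
  have -> : \sum_(e <- s) ((size (rem e s))%:R^-1 * \sum_(d <- rem e s) F d e) =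
     (size s).-1%:R^-1 * \sum_(e <- s) \sum_(d <- rem e s) F d e.
    rewrite mulr_sumr; apply: eq_big_seq => e es; by rewrite size_rem.
  rewrite mulrDr -[f (s, h) *+ _]mulr_natl.
  have -> (a b c : R) : a * (b * (a^-1 * c)) = (a / a) * (b * c) by ring.
  rewrite divff // mul1r [X in _ + X = _]mulrA.
  (* A single active vertex leaves none after freezing, so both sums vanish. *)
  have [s1|s1] := eqVneq (size s) 1%N; last first.
    by rewrite divff ?pnatr_eq0; [ring | lia].
  case: s {s0 kE k0} @F s1 => [|a [|b s]] //= _.
  by rewrite !big_seq1 /= eqxx big_nil; ring.
(* The new vertex is frozen: only the height may have grown. *)
apply: lerD.
  by apply: ler_sum => d _; apply: fI; [exact: perm_dominated | lia].
rewrite big_seq [leRHS]big_seq; apply: ler_sum => e es.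
rewrite [leRHS](perm_big _ (perm_to_rem es)) big_cons lerD2r.
(* The vertex attached to is frozen: depth e is replaced by e + 1. *)
apply: fI; last by lia.
have [z zle [z1 z2]] : dominated (e :: rem e s) (e.+1 :: rem e s).
  by apply: dominated_cons => //; exact: perm_dominated.
by exists z => //; rewrite (permPr (perm_to_rem es)).
Qed.

Lemma expect_stepD xj f g p :
  expect_step xj (fun q => f q + g q) p = expect_step xj f p + expect_step xj g p.
Proof. by rewrite /expect_step; case: ifP => _; rewrite /mean big_split mulrDr. Qed.

Lemma expect_stepZ xj c f p :
  expect_step xj (fun q => c * f q) p = c * expect_step xj f p.
Proof.
by rewrite /expect_step; case: ifP => _; rewrite /mean -mulr_sumr mulrCA.
Qed.

Lemma expect_steps_linear x a b f g p :
  expect_steps x (fun q => a * f q + b * g q) p =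
  a * expect_steps x f p + b * expect_steps x g p.
Proof.
elim: x p => //= xj x IHx p.
rewrite (_ : expect_steps x _ = fun q => a * expect_steps x f q + b * expect_steps x g q).
  by rewrite expect_stepD !expect_stepZ.
by apply/funext => q; rewrite IHx.
Qed.

(** The induction on k is over all increasing f at once, since the induction
hypothesis is applied to the function f averaged over one attachment. *)
Lemma expect_attach_freeze_root f k h : increasing f ->
  expect_steps (nseq k 1) f ([:: h], h) <=
  expect_steps (nseq k.+1 1) (expect_step (-1) f) ([:: h], h).
Proof.
elim: k f => [|k IHk] f fI.
  have := @expect_attach_freeze_ge f ([:: h], h) fI isT => /=. lra.
have nseqS n (g : seq nat * nat -> R) :
    expect_steps (nseq n.+1 1) g = expect_steps (nseq n 1) (expect_step 1 g).
  by rewrite -addn1 nseqD /expect_steps foldr_cat.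
have k0 : 0 < k.+3%:R :> R by [].
rewrite -(ler_pM2l k0) [in leRHS]nseqS.
have -> : k.+3%:R * expect_steps (nseq k.+1 1) (expect_step 1 (expect_step (-1) f)) ([:: h], h)
  = expect_steps (nseq k.+1 1) (fun q => k.+3%:R * (expect_step 1 (expect_step (-1) f)) q
    + 0 * f q) ([:: h], h) by rewrite expect_steps_linear mul0r addr0.
apply: (@le_trans _ _ (expect_steps (nseq k.+1 1) (fun q => 2 * f q +
   k.+1%:R * expect_step (-1) (expect_step 1 f) q) ([:: h], h))); last first.
  apply: le_expect_attachments => q /= q1.
  have := @expect_attach_freeze_ge f q fI; rewrite q1 add1n mul0r addr0; exact.
rewrite expect_steps_linear.
have := IHk _ (@increasing_step 1 f fI).
rewrite -nseqS => le_k.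
have -> : (k.+3%:R : R) = 2 + k.+1%:R by rewrite -natrD.
by rewrite mulrDl lerD2l ler_wpM2l.
Qed.

End profiles.

(** * Depths of the vertices *)

Section depth.
Local Open Scope nat_scope.
Implicit Types (T : tree) (d : nat -> nat).

Definition size_tree T := size (labels T).

(** These conditions force d to be the distance to the root: the second one
prevents walks to v of length less than d v, the third one provides a walk of
that length, short enough to be in the range searched by [distance]. They are
easily seen to survive an attachment, unlike statements on [distance]. *)
Definition depth_function T d : Prop :=
  [/\ d 0 = 0,
      forall u v, Defs.adjacent T u v ->
        [/\ u < size_tree T, v < size_tree T & d v <= (d u).+1] &
      forall v, v < size_tree T -> d v < size_tree T /\ has_walk T (d v) 0 v].

Lemma mem_vertices T v : (v \in vertices T) = (v < size_tree T).
Proof. by rewrite mem_iota. Qed.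

Lemma depth_function_walk T d n u v : depth_function T d ->
  has_walk T n u v -> d v <= d u + n.
Proof.
move=> [_ dadj _]; elim: n u => [|n IHn] u /=; first by move/eqP=> ->; lia.
by case/hasP => w _ /andP[/dadj[_ _ le_w] /IHn]; lia.
Qed.

Lemma distance_depth T d v : depth_function T d -> v < size_tree T ->
  distance T 0 v = d v.
Proof.
move=> dT vT; have [d0 _ dwalk] := dT; have [dv walk_v] := dwalk v vT.
set a := fun n => has_walk T n 0 v.
have has_a : has a (iota 0 (size_tree T)).
  by apply/hasP; exists (d v); rewrite ?mem_iota.
have lt_find : find a (iota 0 (size_tree T)) < size_tree T.
  by rewrite -[ltnRHS](size_iota 0) -has_find.
have := nth_find 0 has_a; rewrite nth_iota // add0n => walk_f.
apply/eqP; rewrite eqn_leq; apply/andP; split; last first.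
  by have := depth_function_walk dT walk_f; rewrite d0 add0n.
rewrite leqNgt; apply/negP => /(before_find 0).
by rewrite nth_iota // add0n /a walk_v.
Qed.

Lemma has_walk_rcons T n u v w : has_walk T n u v -> Defs.adjacent T v w ->
  w < size_tree T -> has_walk T n.+1 u w.
Proof.
move=> + vw wT; elim: n u => [|n IHn] u.
  move/eqP=> -> /=; apply/hasP; exists w; rewrite ?mem_vertices //.
  by rewrite vw eqxx.
case/hasP => y yT /andP[uy /IHn yw].
by apply/hasP; exists y => //; apply/andP.
Qed.

Lemma has_walk_sub T T' n u v : size_tree T <= size_tree T' ->
  subrel (Defs.adjacent T) (Defs.adjacent T') -> has_walk T n u v -> has_walk T' n u v.
Proof.
move=> sT aT; elim: n u => //= n IHn u /hasP[w wT /andP[uw /IHn wv]].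
apply/hasP; exists w; first by move: wT; rewrite !mem_vertices; lia.
by rewrite aT.
Qed.

Lemma size_attach T v : size_tree (attach T v) = (size_tree T).+1.
Proof. exact: size_rcons. Qed.

Lemma size_freeze T v : v < size_tree T -> size_tree (freeze T v) = size_tree T.
Proof. by move=> vT; rewrite /size_tree /= size_set_nth; apply/maxn_idPr. Qed.

Lemma adjacent_attach T v a b : Defs.adjacent (attach T v) a b =
  [|| Defs.adjacent T a b, (a == v) && (b == size_tree T) |
      (b == v) && (a == size_tree T)].
Proof.
rewrite /Defs.adjacent /attach /= !in_cons !xpair_eqE /size_tree.
by do ![case: (_ \in _) | case: (_ == _)].
Qed.

Definition attach_depth T d v u := if u == size_tree T then (d v).+1 else d u.

Lemma depth_function_attach T d v : depth_function T d -> v < size_tree T ->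
  depth_function (attach T v) (attach_depth T d v).
Proof.
move=> [d0 dadj dwalk] vT; rewrite /attach_depth; split.
- by case: eqP => // T0; move: vT; rewrite -T0.
- move=> a b; rewrite size_attach adjacent_attach.
  case/or3P => [/dadj[aT bT le_ab]|/andP[/eqP-> /eqP->]|/andP[/eqP-> /eqP->]].
  + by split; [lia|lia|case: eqP; case: eqP; lia].
  + by rewrite eqxx; split; [lia|lia|case: eqP; lia].
  + by rewrite eqxx; split; [lia|lia|case: eqP; lia].
have sub : subrel (Defs.adjacent T) (Defs.adjacent (attach T v)).
  by move=> a b ab; rewrite adjacent_attach ab.
move=> u; rewrite size_attach => uT; case: eqP => [->|/eqP uN].
  have [dv wv] := dwalk v vT; split => //.
  apply: (@has_walk_rcons _ _ _ v).
  - by apply: has_walk_sub wv; rewrite ?size_attach.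
  - by rewrite adjacent_attach !eqxx orbT.
  - by rewrite size_attach.
have [|du wu] := dwalk u; first by lia.
by split; [lia | apply: has_walk_sub wu; rewrite ?size_attach].
Qed.

Lemma depth_function_freeze T d v : depth_function T d -> v < size_tree T ->
  depth_function (freeze T v) d.
Proof.
move=> [d0 dadj dwalk] vT; split; rewrite ?size_freeze // => u uT.
have [du wu] := dwalk u uT; split => //.
by apply: has_walk_sub wu; rewrite ?size_freeze.
Qed.

(** * Evolution of the profile of a tree *)

Definition profile T : seq nat * nat :=
  ([seq distance T 0 v | v <- active_vertices T], height T).

Lemma active_lt T v : v \in active_vertices T -> v < size_tree T.
Proof. by rewrite mem_filter mem_vertices => /andP[]. Qed.

Lemma profile_depth T d : depth_function T d ->
  profile T = ([seq d v | v <- active_vertices T], \max_(v <- vertices T) d v).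
Proof.
move=> dT; congr (_, _).
  by apply/eq_in_map => v /active_lt; apply: distance_depth.
by apply: eq_big_seq => v; rewrite mem_vertices; apply: distance_depth.
Qed.

Lemma profile_attach T d v : depth_function T d -> v < size_tree T ->
  profile (attach T v) = (rcons (profile T).1 (d v).+1, maxn (profile T).2 (d v).+1).
Proof.
move=> dT vT; rewrite (profile_depth (depth_function_attach dT vT)).
rewrite (profile_depth dT) /=.
have vE : vertices (attach T v) = rcons (vertices T) (size_tree T).
  by rewrite /vertices /= size_rcons -addn1 iotaD cats1.
have dE : {in vertices T, attach_depth T d v =1 d}.
  by move=> u; rewrite mem_vertices /attach_depth; case: eqP => //; lia.
have dN : attach_depth T d v (size_tree T) = (d v).+1 by rewrite /attach_depth eqxx.
congr (_, _).
  rewrite /active_vertices vE filter_rcons /= nth_rcons ltnn eqxx map_rcons dN.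
  congr rcons.
  rewrite (eq_in_filter (a2 := nth false (labels T))); last first.
    by move=> u; rewrite mem_vertices nth_rcons /size_tree => ->.
  by apply/eq_in_map => u; rewrite mem_filter => /andP[_ /dE].
by rewrite vE big_rcons /= dN (eq_big_seq _ dE).
Qed.

Lemma profile_freeze T d v : depth_function T d -> v \in active_vertices T ->
  perm_eq (profile (freeze T v)).1 (rem (d v) (profile T).1) /\
  (profile (freeze T v)).2 = (profile T).2.
Proof.
move=> dT vA; have vT := active_lt vA.
rewrite (profile_depth (depth_function_freeze dT vT)) (profile_depth dT) /=.
have vE : vertices (freeze T v) = vertices T.
  by have := size_freeze vT; rewrite /vertices /size_tree => ->.
rewrite vE; split => //.
rewrite -(perm_cons (d v)) -(permPr (perm_to_rem (map_f d vA))) perm_sym.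
have -> : active_vertices (freeze T v) = rem v (active_vertices T).
  rewrite rem_filter ?filter_uniq ?iota_uniq // /active_vertices vE -filter_predI.
  by apply: eq_filter => u /=; rewrite nth_set_nth /=; case: eqP.
by have := perm_map d (perm_to_rem vA).
Qed.

Lemma depth_function_root : depth_function root_tree id.
Proof. by split=> //; case. Qed.

Lemma profile_root : profile root_tree = ([:: 0], 0).
Proof. by rewrite (profile_depth depth_function_root) /vertices /= big_seq1. Qed.

End depth.

(** * Law of the height *)

Local Open Scope classical_set_scope.

Lemma build_rcons (x : seq int) (v : seq nat) u : (size v < size x)%N ->
  build (take (size v).+1 x) (rcons v u) =
  step (build (take (size v) x) v) (nth 0 x (size v)) u.
Proof.
move=> vx; rewrite (take_nth 0) // /build zip_rcons ?foldl_rcons //.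
by rewrite size_take vx.
Qed.

Lemma depth_function_step T xj u d : depth_function T d -> u \in active_vertices T ->
  exists d', depth_function (step T xj u) d'.
Proof.
move=> dT uA; have uT := active_lt uA; rewrite /step; case: ifP => _.
  by exists (attach_depth T d u); apply: depth_function_attach.
by exists d; apply: depth_function_freeze.
Qed.

Section law.
Context (R : realType) (d : measure_display) (Omega : measurableType d).
Context (P : probability Omega R).
Implicit Types (V : nat -> {RV P >-> nat}).

Lemma expect_step_profile xj (f : seq nat * nat -> R) T e :
  increasing f -> depth_function T e ->
  expect_step xj f (profile T) =
  mean (active_vertices T) (fun u => f (profile (step T xj u))).
Proof.
move=> fI eT; rewrite /expect_step /step.
have dE : {in active_vertices T, forall u, distance T 0 u = e u}.
  by move=> u /active_lt; apply: distance_depth.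
case: ifP => _; rewrite /mean size_map big_map; congr (_ * _);
  apply: eq_big_seq => u uA; rewrite dE //.
  rewrite (profile_attach eT (active_lt uA)).
  by apply: increasing_perm => //; rewrite perm_sym perm_rcons.
have [pE hE] := profile_freeze eT uA.
by rewrite [profile (freeze T u)]surjective_pairing hE; apply: increasing_perm => //;
  rewrite perm_sym.
Qed.

Lemma sum_uniform (s : seq nat) (c : R) (g : nat -> R) : uniq s -> 0 <= c ->
  (forall u, 0 <= g u) ->
  (\sum_(0 <= u <oo) (c * uniform_on R s u * g u)%:E = (c * mean s g)%:E)%E.
Proof.
move=> us c0 g0.
have [n sn] : exists n, forall u, u \in s -> (u < n)%N.
  by exists (\max_(u <- s) u).+1 => u us'; rewrite ltnS; exact: (leq_bigmax_seq u).
have u0 u : 0 <= uniform_on R s u.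
  by rewrite /uniform_on; case: ifP => // _; rewrite invr_ge0.
rewrite (nneseries_split 0 n); last by move=> u _; rewrite lee_fin !mulr_ge0.
rewrite add0n eseries0 ?adde0; last first.
  move=> u nu _; rewrite /uniform_on; case: ifP => [/sn|]; first by lia.
  by rewrite mulr0 mul0r.
rewrite sumEFin; congr (_%:E).
under eq_bigr do rewrite -mulrA.
rewrite -mulr_sumr; congr (c * _); rewrite /mean mulr_sumr.
rewrite (bigID (mem s)) /= [X in _ + X]big1 ?addr0; last first.
  by move=> u /negbTE us'; rewrite /uniform_on us' mul0r.
rewrite -big_filter.
rewrite (perm_big s) /=; last first.
  apply: uniq_perm; rewrite ?filter_uniq ?iota_uniq // => u.
  rewrite mem_filter mem_index_iota /=; case: (boolP (u \in s)) => //= /sn ->.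
  by [].
by apply: eq_big_seq => u us'; rewrite /uniform_on us'.
Qed.

Lemma choices_take V j m w : (j <= m)%N -> choices V j w = take j (choices V m w).
Proof. by move=> jm; rewrite /choices /mkseq -map_take take_iota (minn_idPl jm). Qed.

Definition height_indicator (Q : pred nat) (p : seq nat * nat) : R := (Q p.2)%:R.

Lemma expect_steps_ge0 x (f : seq nat * nat -> R) :
  (forall p, 0 <= f p) -> forall p, 0 <= expect_steps x f p.
Proof.
move=> f0; elim: x => //= xj x IHx p; rewrite /expect_step.
by case: ifP => _; rewrite mulr_ge0 ?invr_ge0 ?ler0n ?sumr_ge0.
Qed.

(** Conditionally on the past v, the law of the height only depends on the
profile of the tree built from v. The induction goes backwards in time: the
next choice u is uniform on the active vertices, and each past rcons v u is
covered by the induction hypothesis. Inactive u have probability 0; they must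
be discarded first, as the tree built from them need not have depths. *)
Lemma choices_height x V (Q : pred nat) y v e :
  increasing (height_indicator Q) ->
  uniform_attachment_freezing x V ->
  (size v + size y)%N = size x -> drop (size v) x = y ->
  depth_function (build (take (size v) x) v) e ->
  (P [set w | choices V (size v) w = v /\ Q (height (random_tree x V w))] =
   P [set w | choices V (size v) w = v] *
     (expect_steps y (height_indicator Q) (profile (build (take (size v) x) v)))%:E)%E.
Proof.
move=> QI xV; elim: y v e => [|xj y IHy] v e; rewrite ?addn0.
  move=> vx _ _; rewrite vx take_size /= /height_indicator /= /random_tree.
  case: (boolP (Q (height (build x v)))) => Qv.
    rewrite mule1; congr (P _); apply/seteqP; split => w /= [] //.
    by move=> -> ; split.
  rewrite mule0 -[RHS](measure0 P); congr (P _); apply/seteqP; split => w //=.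
  by move=> [->]; rewrite (negbTE Qv).
move=> /= vx vy eT.
have vltx : (size v < size x)%N by rewrite -vx; lia.
have xjE : nth 0 x (size v) = xj by rewrite -[size v]addn0 -nth_drop vy.
have yE : drop (size v).+1 x = y by rewrite -addn1 addnC -drop_drop vy drop1.
set T := build (take (size v) x) v in eT *.
set c := P [set w | choices V (size v) w = v].
have choicesS w u : choices V (size v).+1 w = rcons v u <->
    choices V (size v) w = v /\ V (size v) w = u.
  rewrite /choices mkseqS; split; first by move/rcons_inj => [].
  by move=> [-> ->].
pose F u := [set w | choices V (size v).+1 w = rcons v u /\
  Q (height (random_tree x V w))].
have mF u : measurable (F u).
  rewrite (_ : F u = [set w | [set s | take (size v).+1 s = rcons v u /\
     Q (height (build x s))] (choices V (size x) w)]); first exact: measurable_choices.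
  by apply/seteqP; split => w /=; rewrite -choices_take.
have -> : [set w | choices V (size v) w = v /\ Q (height (random_tree x V w))] =
    \bigcup_u F u.
  apply/seteqP; split => w /=.
    by move=> [vw Qw]; exists (V (size v) w) => //; split => //; apply/choicesS.
  by move=> [u _ [/choicesS[vw _] Qw]].
have tF : trivIset setT F.
  by move=> u1 u2 _ _ [w [[/choicesS[_ <-] _] [/choicesS[_ <-] _]]].
rewrite measure_bigcup //.
have cfin : c = (fine c)%:E.
  rewrite fineK // fin_num_measure //.
  exact: (measurable_choices V (size v) [set s | s = v]).
have PFE u : P (F u) = (fine c * uniform_on R (active_vertices T) u *
    expect_steps y (height_indicator Q) (profile (step T xj u)))%:E.
  have PE : P [set w | choices V (size v).+1 w = rcons v u] =
      (c * (uniform_on R (active_vertices T) u)%:E)%E.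
    rewrite -xV //; congr (P _); apply/seteqP; split => w /=; by move/choicesS.
  case: (boolP (u \in active_vertices T)) => uA.
    have [e' eT'] := depth_function_step xj eT uA.
    have := IHy (rcons v u) e'; rewrite size_rcons build_rcons // xjE => -> //; last by lia.
    by rewrite PE cfin -!EFinM.
  rewrite {1}/uniform_on (negbTE uA) mulr0 mul0r.
  apply/eqP; rewrite -measure_le0.
  apply: (@le_trans _ _ (P [set w | choices V (size v).+1 w = rcons v u])).
    apply: le_measure; rewrite ?inE //; last by move=> w [].
    exact: (measurable_choices V (size v).+1 [set s | s = rcons v u]).
  by rewrite PE /uniform_on (negbTE uA) mule0.
under eq_eseriesl do rewrite in_setT.
rewrite (eq_eseriesr (fun u _ => PFE u)).
rewrite sum_uniform ?filter_uniq ?iota_uniq ?fine_ge0 ?measure_ge0 //; last first.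
  by move=> u; apply: expect_steps_ge0 => p; exact: ler0n.
rewrite EFinM -cfin; congr (_ * _%:E)%E.
by rewrite -(expect_step_profile _ _ eT) //; exact: increasing_steps.
Qed.

Lemma prob_height x V (Q : pred nat) :
  increasing (height_indicator Q) ->
  uniform_attachment_freezing x V ->
  P [set w | Q (height (random_tree x V w))] =
  (expect_steps x (height_indicator Q) ([:: 0], 0)%N)%:E.
Proof.
move=> QI xV.
have := @choices_height x V Q x [::] id QI xV erefl (drop0 x).
rewrite /= take0 profile_root => /(_ depth_function_root).
rewrite (_ : [set w | choices V 0 w = [::]] = setT); last by apply/seteqP; split.
rewrite probability_setT mul1e => <-; congr (P _).
by apply/seteqP; split => w //= [].
Qed.

End law.

Lemma increasing_height_ge (R : realType) (t : R) :
  increasing (height_indicator R (fun n => t <= n%:R)).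
Proof.
move=> a b h h' _ hh'; rewrite /height_indicator /= ler_nat.
by case: (boolP (t <= h%:R)) => // th; rewrite (le_trans th) // ler_nat.
Qed.

Local Close Scope classical_set_scope.

Theorem theorem3 (R : realType) (x : seq int) (k : nat)
  (d1 d2 : measure_display)
  (Omega1 : measurableType d1) (P1 : probability Omega1 R)
  (Omega2 : measurableType d2) (P2 : probability Omega2 R)
  (V1 : nat -> {RV P1 >-> nat}) (V2 : nat -> {RV P2 >-> nat}) :
  (forall xi : int, xi \in x -> xi = 1 \/ xi = -1) ->
  (forall j : nat, (1 <= j <= (size x).-1)%N -> 0 < partial_sum x j) ->
  (1 <= k <= (size x).-1)%N ->
  (forall i : nat, (1 <= i <= k)%N -> nth 0 x i.-1 = 1) ->
  nth 0 x k = -1 ->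
  uniform_attachment_freezing (remove_pair x k) V1 ->
  uniform_attachment_freezing x V2 ->
  stochastically_dominated (height_rv (remove_pair x k) V1) (height_rv x V2).
Proof.
move=> _ _; case: k => [|k] //= kx x1 xk xV1 xV2 t.
have {}kx : (k.+1 < size x)%N by rewrite -ltn_predRL.
have takeE : take k.+1 x = nseq k.+1 1.
  apply: (@eq_from_nth _ 0); rewrite size_takel ?size_nseq ?(ltnW kx) //.
  by move=> i ik; rewrite nth_take // nth_nseq ik; apply: (x1 i.+1).
have xE : x = nseq k.+1 1 ++ -1 :: drop k.+2 x.
  by rewrite -takeE -xk -drop_nth // cat_take_drop.
have rE : remove_pair x k.+1 = nseq k 1 ++ drop k.+2 x.
  congr (_ ++ _); rewrite xE take_cat size_nseq ltnS leqnn.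
  by rewrite -{2}(addn1 k) nseqD take_size_cat ?size_nseq.
have Qt := increasing_height_ge t.
rewrite [leLHS](prob_height Qt xV1) [leRHS](prob_height Qt xV2) lee_fin rE.
rewrite [in leRHS]xE /expect_steps !foldr_cat -/(expect_steps _ _) /=.
exact: expect_attach_freeze_root (increasing_steps _ Qt).
Qed.
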